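(* Let $n\ge 1$ and consider the Hankel pencil $U_0-zU_1$ with $U_0,U_1\in\mathbb C^{n\times n}$, $U_0[i,j]=s_{i+j+1}$, $U_1[i,j]=s_{i+j}$ ($i,j=0,\dots,n-1$). Then for all $(s_0,\dots,s_{2n-1})\in\mathbb C^{2n}$ except a proper semialgebraic subset of $\mathbb C^{2n}$ the eigenvalues of the pencil are simple, and in such a case the matrix $J_n$ is a companion matrix of the pencil, in the sense that the spectra of $J_n$ and of $U_0-zU_1$ coincide.
   Context: The eigenvalues (spectrum) of the pencil $U_0-zU_1$ are the zeros of the polynomial $\det(U_0-zU_1)$; semialgebraic subsets of $\mathbb C^{2n}$ are understood via $\mathbb C^{2n}\cong\mathbb R^{4n}$. The matrix $J_n$ is constructed from $s_0,\dots,s_{2n-1}$ as follows. Define $f_l^k$ by $f_{-2}^k=f_{-1}^k=\delta_{0,k}$, $f_0^k=s_k$, and $f_{l+1}^k=\frac{(-1)^l}{f_{l-2}^0}\left[f_l^0f_{l-1}^{k+1}-f_{l-1}^0f_l^{k+1}\right]$ for $l\ge 0$ ($f_l^k$ depends only on $s_0,\dots,s_{l+k}$). Standing assumption whenever $J_n$ is considered: $f_l^0\ne 0$ for $0\le l\le 2n-1$. Put $r_l=(-1)^{l-1}\frac{f_l^0f_{l-3}^0}{f_{l-2}^0f_{l-1}^0}$ for $1\le l\le 2n-1$, $c_0=-r_1$, and for $1\le l\le n-1$: $c_l=-(r_{2l}+r_{2l+1})$, $d_l=r_{2l-1}r_{2l}$. Then $J_n$ is the $n\times n$ tridiagonal matrix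 with diagonal $c_0,\dots,c_{n-1}$, superdiagonal entries all $1$, and subdiagonal $d_1,\dots,d_{n-1}$. *)

(* Defs.v *)
From HB Require Import structures.
From mathcomp Require Import all_boot all_order all_algebra.
From mathcomp Require Import mpoly complex.
From mathcomp Require Import classical_sets reals.

Set Implicit Arguments.
Unset Strict Implicit.
Unset Printing Implicit Defensive.

Import Order.TTheory GRing.Theory Num.Theory.

Local Open Scope classical_set_scope.
Local Open Scope ring_scope.
Local Open Scope complex_scope.

(* A semialgebraic subset of R^m is a finite union of sets of the form
   {P_1 = ... = P_a = 0, Q_1 > 0, ..., Q_b > 0}; the list [D] holds one pair
   ([:: P_1; ...; P_a], [:: Q_1; ...; Q_b]) for each set of the union. *)
Definition semialgebraic (R : rcfType) (m : nat) (A : set (m.-tuple R)) : Prop :=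
  exists D : seq (seq {mpoly R[m]} * seq {mpoly R[m]}),
    forall x : m.-tuple R,
      A x <-> has (fun d => all (fun p : {mpoly R[m]} => p.@[tnth x] == 0) d.1
                         && all (fun q : {mpoly R[m]} => 0 < q.@[tnth x]) d.2) D.

(* The identification of C^m with R^(2m). *)
Definition real_coords (R : rcfType) (m : nat) (s : m.-tuple R[i]) :
    (m + m).-tuple R :=
  [tuple of [seq complex.Re z | z <- s] ++ [seq complex.Im z | z <- s]].

Definition complex_semialgebraic (R : rcfType) (m : nat)
    (S : set (m.-tuple R[i])) : Prop :=
  semialgebraic (@real_coords R m @` S).

Section Pencil.
Variables (C : fieldType) (n : nat) (s : (n.*2).-tuple C).

Definition hankel_U0 : 'M[C]_n := \matrix_(i < n, j < n) s`_(i + j + 1).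

Definition hankel_U1 : 'M[C]_n := \matrix_(i < n, j < n) s`_(i + j).

Definition pencil_poly : {poly C} :=
  \det (map_mx polyC hankel_U0 - 'X *: map_mx polyC hankel_U1).

(* This fails when the pencil is singular ([pencil_poly = 0]): then every
   point is a root, while [mup z 0 = 0]. *)
Definition simple_eigenvalues : Prop :=
  forall z : C, root pencil_poly z -> mup z pencil_poly = 1%N.

(* The first index is shifted by 2, so as to be a natural number:
   [fshift m k] is f_{m-2}^k.  Only entries with m - 2 + k <= 2n - 1 matter
   below; they involve no out-of-range term of s. *)
Fixpoint fshift (m k : nat) {struct m} : C :=
  match m with
  | 0 | 1 => (k == 0%N)%:R
  | 2 => s`_k
  | ((l.+1 as l1).+1 as l2).+1 =>
      (-1) ^+ l / fshift l 0
        * (fshift l2 0 * fshift l1 k.+1 - fshift l1 0 * fshift l2 k.+1)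
  end.

Definition J_defined : Prop :=
  forall l : nat, (l < n.*2)%N -> fshift l.+2 0 != 0.

(* r_l, meant for 1 <= l <= 2n - 1. *)
Definition r_coef (l : nat) : C :=
  (-1) ^+ l.-1 * (fshift l.+2 0 * fshift l.-1 0)
    / (fshift l 0 * fshift l.+1 0).

Definition c_coef (l : nat) : C :=
  if l == 0%N then - r_coef 1 else - (r_coef l.*2 + r_coef l.*2.+1).

(* d_l, meant for 1 <= l <= n - 1. *)
Definition d_coef (l : nat) : C := r_coef l.*2.-1 * r_coef l.*2.

Definition J_mx : 'M[C]_n :=
  \matrix_(i < n, j < n)
    if i == j then c_coef i
    else if j == i.+1 :> nat then 1
    else if i == j.+1 :> nat then d_coef i
    else 0.

End Pencil.

(* Main.v *)
Require Import Defs.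
From HB Require Import structures.
From mathcomp Require Import all_boot all_order all_algebra.
From mathcomp Require Import mpoly complex.
From mathcomp Require Import classical_sets reals.
From mathcomp Require Import zify ring.

(** Read [s] as the moments of a linear functional [moment s] on polynomials,
    sending ['X^k] to [s`_k].  The numbers [r_l] drive the recurrence
    [qd_poly], which interleaves the monic polynomials [p_m] (even indices)
    and [q_m] (odd indices) orthogonal for the weights [1] and [x].  The array
    [f_l^k], divided by [f_(l-2)^0] and up to sign, is exactly the array of
    moments of these polynomials, and its definition encodes their
    orthogonality ([moment_qd_poly]).  Eliminating the [q_m] leaves the
    three-term recurrence whose coefficients are the [c_l] and [d_l]: modulo
    [p_n], multiplication by ['X] on [p_0, ..., p_(n-1)] is the matrix [J_n].

    Let [A] be the matrix of coefficients of the [p_m], unitriangular.  Since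
    [p_n] is orthogonal to all degrees below [n], taking moments gives
    [A U_0 = J_n (A U_1)]; and [A U_1] is triangular with the nonzero squared
    norms [f_(2m)^0 / f_(2m-2)^0] on its diagonal, up to sign.  Hence the
    pencil polynomial is a nonzero multiple of the characteristic polynomial
    of [J_n] ([pencil_poly_char_poly]), and the spectra coincide.

    The exceptional set is in fact the zero set of one complex polynomial
    ([exceptional_polyP]).  Dropping the divisions from the recurrence of
    [f_l^k] multiplies each level by a factor which is nonzero as long as
    the earlier [f_l^0] are, so that [J_n] is defined exactly where the
    product of the division-free values does not vanish.  There the pencil
    polynomial has degree exactly [n], and its zeros are simple exactly when
    its resultant with its derivative is nonzero.  Separating real and
    imaginary parts turns a complex zero set into a real algebraic set.

    That set is not everything: the power sums [s_k = \sum_i x_i ^ k] of the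
    nodes [1, ..., n] lie outside it.  The functional is then a sum of point
    evaluations, so the pencil has the distinct eigenvalues [x_i], and
    positivity of the weights [1] and [x] on the nodes prevents any [f_l^0]
    from vanishing. *)

Set Implicit Arguments.
Unset Strict Implicit.
Unset Printing Implicit Defensive.

Import Order.TTheory GRing.Theory Num.Theory.

Local Open Scope classical_set_scope.
Local Open Scope ring_scope.
Local Open Scope complex_scope.

(** * Moments of polynomials *)

Lemma poly_wide (C : fieldType) N (p : {poly C}) : (size p <= N)%N ->
  p = \sum_(k < N) p`_k *: 'X^k.
Proof.
move=> szp; rewrite -poly_def; apply/polyP=> k; rewrite coef_poly.
by case: ltnP => // leNk; rewrite nth_default // (leq_trans szp).
Qed.

Section Moments.
Variables (C : fieldType) (s : seq C).

Definition moment (p : {poly C}) : C := \sum_(i < size s) s`_i * p`_i.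

Lemma moment_is_linear : scalar moment.
Proof.
move=> a p q; rewrite /moment mulr_sumr -big_split /=; apply: eq_bigr => i _.
by rewrite coefD coefZ; ring.
Qed.

HB.instance Definition _ :=
  GRing.isLinear.Build C {poly C} C *%R moment moment_is_linear.

Lemma momentXn k : moment 'X^k = s`_k.
Proof.
rewrite /moment; have [ltk|gek] := ltnP k (size s).
  rewrite (bigD1 (Ordinal ltk)) //= coefXn eqxx mulr1 big1 ?addr0 // => i ne.
  by rewrite coefXn -val_eqE /= in ne *; rewrite (negPf ne) mulr0.
rewrite nth_default // big1 // => i _.
by rewrite coefXn ltn_eqF ?mulr0 //; apply: leq_trans gek.
Qed.

Lemma moment_mulXn N (p : {poly C}) j : (size p <= N)%N ->
  moment (p * 'X^j) = \sum_(k < N) p`_k * s`_(k + j).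
Proof.
move=> szp; rewrite {1}(poly_wide szp) mulr_suml linear_sum.
apply: eq_bigr => k _ /=.
by rewrite -scalerAl linearZ /= -exprD momentXn.
Qed.

End Moments.

(** * The interleaved orthogonal polynomials *)

Section OrthogonalPolynomials.
Variable (C : fieldType).
Implicit Type r : nat -> C.

(** Index [m.*2] is [p_m] and index [m.*2.+1] is [q_m], both of degree [m];
    the two steps are [q_m = p_m + r_(2m) q_(m-1)] and
    [p_(m+1) = x q_m + r_(2m+1) p_m]. *)
Fixpoint qd_poly r (l : nat) : {poly C} :=
  match l with
  | (l1.+1 as l2).+1 => 'X^(odd l2) * qd_poly r l2 + r l2 *: qd_poly r l1
  | _ => 1
  end.

Lemma qd_polySS r l :
  qd_poly r l.+2 = 'X^(odd l.+1) * qd_poly r l.+1 + r l.+1 *: qd_poly r l.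
Proof. by []. Qed.

Lemma qd_poly_monic_size r l :
  (qd_poly r l \is monic) * (size (qd_poly r l) = l./2.+1).
Proof.
elim/ltn_ind: l => -[|[|l]] IHl; rewrite ?monic1 ?size_poly1 // qd_polySS.
have [[mon1 sz1] [_ sz0]] := (IHl l.+1 (leqnn _), IHl l (leqnSn _)).
set a := 'X^_ * _; set b := r _ *: _.
have sza : size a = l.+2./2.+1.
  rewrite size_monicM ?monicXn ?monic_neq0 // size_polyXn sz1 /= uphalf_half.
  by lia.
have lt_ba : (size b < size a)%N.
  by rewrite (leq_ltn_trans (size_scale_leq _ _)) // sz0 sza /=; lia.
by rewrite size_polyDl // monicE lead_coefDl // -monicE monicMr ?monicXn.
Qed.

Lemma size_qd_poly r l : size (qd_poly r l) = l./2.+1.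
Proof. by rewrite qd_poly_monic_size. Qed.

Lemma qd_poly_monic r l : qd_poly r l \is monic.
Proof. by rewrite qd_poly_monic_size. Qed.

Lemma qd_poly1_Jacobi r : qd_poly r 2 = 'X + r 1%N *: 1.
Proof. by rewrite qd_polySS /= mulr1. Qed.

(** Eliminating the odd-indexed polynomials leaves a three-term recurrence;
    its coefficients are those of the tridiagonal matrix. *)
Lemma qd_poly_Jacobi r m :
  qd_poly r m.+2.*2 = 'X * qd_poly r m.+1.*2
    + (r m.+1.*2 + r m.+1.*2.+1) *: qd_poly r m.+1.*2
    - (r m.*2.+1 * r m.+1.*2) *: qd_poly r m.*2.
Proof.
rewrite !doubleS; have dF: odd m.*2 = false by rewrite odd_double.
rewrite (qd_polySS r m.*2.+2) (qd_polySS r m.*2.+1) (qd_polySS r m.*2) /= dF /=.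
rewrite !expr1 !expr0 !mul1r -!mul_polyC !polyCD !polyCM.
by ring.
Qed.

End OrthogonalPolynomials.

(** * The array of the recurrence as moments *)

Section Companion.
Variables (C : fieldType) (n : nat) (s : (n.*2).-tuple C).

Local Notation F := (fshift s).
Local Notation P := (qd_poly (r_coef s)).

(** In this normalization the nonlinear recurrence of [f_l^k] becomes linear,
    with the coefficients [r_l] of [qd_poly]; the sign [(-1) ^+ uphalf l] is
    [(-1) ^+ (l * (l + 1) / 2)], the product of the signs [(-1) ^+ i] for
    [i <= l]. *)
Definition qd_moment (l k : nat) : C := (-1) ^+ uphalf l * F l.+2 k / F l 0.

Lemma fshift_rec l k :
  F l.+3 k = (-1) ^+ l / F l 0
        * (F l.+2 0 * F l.+1 k.+1 - F l.+1 0 * F l.+2 k.+1).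
Proof. by []. Qed.

Lemma qd_moment_rec l k :
    F l 0 != 0 -> F l.+1 0 != 0 -> F l.+2 0 != 0 ->
  qd_moment l.+2 k = qd_moment l.+1 k.+1 + r_coef s l.+1 * qd_moment l k.+1.
Proof.
rewrite /qd_moment /r_coef fshift_rec [l.+1.-1]/=.
move: (F l 0) (F l.+1 0) (F l.+2 0) (F l.+3 0) (F l.+2 k.+1) (F l.+3 k.+1).
move=> a0 a1 a2 a3 b c a00 a10 a20.
rewrite [uphalf l.+2]/= [uphalf l.+1]/= !exprS.
have -> : (-1) ^+ l./2 = (-1) ^+ uphalf l * (-1) ^+ l :> C.
  by rewrite -exprD -signr_odd -[RHS]signr_odd oddD uphalf_half oddD oddb
             addbAC addbb.
have e : (-1) ^+ l * (-1) ^+ l = 1 :> C by rewrite -expr2 sqrr_sign.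
by field: e; rewrite a00 a10 a20.
Qed.

(** The value of [r_(l+1)] is the one that makes the next moment vanish. *)
Lemma qd_moment_cancel l :
    F l 0 != 0 -> F l.+1 0 != 0 -> F l.+2 0 != 0 ->
  qd_moment l.+1 0 + r_coef s l.+1 * qd_moment l 0 = 0.
Proof.
rewrite /qd_moment /r_coef [l.+1.-1]/=.
move: (F l 0) (F l.+1 0) (F l.+2 0) (F l.+3 0) => a0 a1 a2 a3 a00 a10 a20.
have -> : (-1) ^+ uphalf l = (-1) ^+ l./2 * (-1) ^+ l :> C.
  by rewrite -exprD -signr_odd -[RHS]signr_odd oddD uphalf_half oddD oddb addbC.
rewrite [uphalf l.+1]/= exprS.
have e : (-1) ^+ l * (-1) ^+ l = 1 :> C by rewrite -expr2 sqrr_sign.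
by field: e; rewrite a00 a10 a20.
Qed.

(** Each step of [qd_poly] preserves the orthogonality relations that hold for
    both of its terms, and [r_l] is chosen so that one more moment vanishes
    ([qd_moment_cancel]).  The odd-indexed polynomials are orthogonal for the
    weight [x], hence their range of exponents starts at [1]. *)
Lemma moment_qd_poly l : (forall i, (i <= l)%N -> F i 0 != 0) ->
  (forall k, moment s (P l * 'X^(uphalf l + k)) = qd_moment l k)
  /\ (forall j, (odd l <= j < uphalf l)%N -> moment s (P l * 'X^j) = 0).
Proof.
elim/ltn_ind: l => -[|[|l]] IHl F_neq0.
- split=> // k; rewrite mul1r momentXn /qd_moment /= expr0.
  by rewrite mul1r divr1.
- split=> [k|j]; last by case: j.
  rewrite mul1r momentXn /qd_moment fshift_rec /=.
  by rewrite expr0 expr1 !divr1 mulr0 sub0r !mul1r mulN1r opprK.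
have [mom1 orth1] := IHl l.+1 (leqnn _) (fun i h => F_neq0 i (leqW h)).
have [mom0 orth0] := IHl l (leqnSn _) (fun i h => F_neq0 i (leqW (leqW h))).
have step j : moment s (P l.+2 * 'X^j) =
    moment s (P l.+1 * 'X^(j + odd l.+1))
    + r_coef s l.+1 * moment s (P l * 'X^j).
  rewrite qd_polySS mulrDl linearD /= -scalerAl linearZ /=.
  by congr (moment s _ + _); rewrite exprD; ring.
have up : uphalf l.+1 = (uphalf l + odd l.+1)%N.
  by rewrite /= [uphalf l]uphalf_half; case: (odd l); lia.
split=> [k|j /andP[le_j lt_j]]; rewrite step.
  rewrite [uphalf l.+2]/= addSnnS mom0 addnAC -up mom1.
  by rewrite qd_moment_rec //; apply: F_neq0; lia.
(* the new exponent [j = uphalf l] is where [r_(l+1)] acts *)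
move: lt_j; rewrite [uphalf l.+2]/= ltnS leq_eqVlt => /orP[/eqP->|lt_j].
  have := mom0 0%N; have := mom1 0%N; rewrite !addn0 -up => -> ->.
  by rewrite qd_moment_cancel //; apply: F_neq0; lia.
rewrite orth1 ?orth0 ?mulr0 ?addr0 // ?lt_j ?andbT //; last first.
  by rewrite up ltn_add2r lt_j leq_addl.
by move: le_j; rewrite /= negbK.
Qed.

(** * Companion matrix of the pencil *)

Lemma sum_ord_delta (N a : nat) (G : nat -> {poly C}) :
  \sum_(k < N) (k == a :> nat)%:R *: G k = if (a < N)%N then G a else 0.
Proof.
case: ltnP => [lt_aN|le_Na].
  rewrite (bigD1 (Ordinal lt_aN)) //= eqxx scale1r big1 ?addr0 // => i.
  by rewrite -val_eqE /= => /negPf->; rewrite scale0r.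
rewrite big1 // => i _.
by rewrite ltn_eqF ?scale0r // (leq_trans (ltn_ord i)).
Qed.

(** The three-term recurrence, read as multiplication by ['X] on the span of
    [p_0, ..., p_(n-1)]: only the last row leaves this span, along [p_n]. *)
Lemma J_mx_qd_poly (i : 'I_n) :
  'X * P i.*2 = \sum_(k < n) J_mx s i k *: P k.*2
                + (i.+1 == n)%:R *: P n.*2.
Proof.
have JE (k : 'I_n) : J_mx s i k *: P k.*2 =
    (k == i :> nat)%:R *: (c_coef s k *: P k.*2) +
    (k == i.+1 :> nat)%:R *: P k.*2 +
    (0 < i)%:R *: ((k == i.-1 :> nat)%:R *: (d_coef s k.+1 *: P k.*2)).
  rewrite mxE -[i == k]val_eqE [val i == _]eq_sym /=.
  have [->|ne] := eqVneq (k : nat) i.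
    rewrite scale1r [_ == _.+1]ltn_eqF // scale0r addr0.
    case: (posnP i) => [->|i_gt0]; first by rewrite scale0r addr0.
    by rewrite (_ : _ == i.-1 = false) ?scale0r ?scaler0 ?addr0 //; lia.
  rewrite scale0r add0r; have [eqk|_] := eqVneq (k : nat) i.+1.
    by rewrite (_ : _ == i.-1 = false) ?scale0r ?scaler0 ?addr0 //; lia.
  rewrite scale0r add0r; have [eqi|ne2] := eqVneq (i : nat) k.+1.
    by rewrite eqi /= eqxx !scale1r.
  case: (posnP i) => [_|i_gt0]; first by rewrite !scale0r.
  by rewrite (_ : _ == i.-1 = false) ?scale0r ?scaler0 //; lia.
rewrite (eq_bigr _ (fun k _ => JE k)) !big_split /= -scaler_sumr.
rewrite (sum_ord_delta _ _ (fun k => c_coef s k *: P k.*2)).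
rewrite (sum_ord_delta _ _ (fun k => P k.*2)).
rewrite (sum_ord_delta _ _ (fun k => d_coef s k.+1 *: P k.*2)).
rewrite ltn_ord (leq_ltn_trans (leq_pred i)) //.
set t := (if _ then _ else _); set t' := _ *: P n.*2.
have tE : t + t' = P i.+1.*2.
  rewrite /t /t'; have := ltn_ord i; have [eqn|ne] := eqVneq i.+1 n.
    by rewrite eqn ltnn scale1r add0r.
  by rewrite leq_eqVlt (negPf ne) /= => ->; rewrite scale0r addr0.
rewrite [_ + t + _]addrAC -(addrA _ t t') tE /c_coef /d_coef.
case: (nat_of_ord i) => [|m].
  rewrite (qd_poly1_Jacobi _ : P 1.*2 = _) /= scale0r addr0 mulr1 scaleNr.
  by rewrite addrC addrK.
by rewrite scale1r qd_poly_Jacobi /= -!mul_polyC !polyCN !polyCD !polyCM; ring.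
Qed.

Definition qd_coef_mx : 'M[C]_n := \matrix_(i, j) (P i.*2)`_j.

Lemma det_qd_coef_mx : \det qd_coef_mx = 1.
Proof.
rewrite det_trig; last first.
  apply/is_trig_mxP => i j lt_ij; rewrite mxE nth_default //.
  by rewrite size_qd_poly doubleK.
rewrite big1 // => i _; rewrite mxE.
have /monicP := qd_poly_monic (r_coef s) i.*2.
by rewrite /lead_coef size_qd_poly doubleK.
Qed.

Lemma qd_coef_mx_U1E (i j : 'I_n) :
  (qd_coef_mx *m hankel_U1 s) i j = moment s (P i.*2 * 'X^j).
Proof.
rewrite mxE (moment_mulXn s _ (N := n)) ?size_qd_poly ?doubleK //.
by apply: eq_bigr => l _; rewrite !mxE.
Qed.

Lemma qd_coef_mx_U0E (i j : 'I_n) :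
  (qd_coef_mx *m hankel_U0 s) i j = moment s ('X * P i.*2 * 'X^j).
Proof.
rewrite -mulrA mulrCA -exprS.
rewrite (moment_mulXn s _ (N := n)) ?size_qd_poly ?doubleK // mxE.
by apply: eq_bigr => l _; rewrite !mxE addn1 addnS.
Qed.

Hypothesis J_def : J_defined s.

Lemma fshift_neq0 i : (i <= n.*2.+1)%N -> F i 0 != 0.
Proof.
by case: i => [|[|l]] ltl; rewrite ?oner_eq0 //; apply: J_def.
Qed.

(** Taking moments of [J_mx_qd_poly] against ['X^j]: the term in [p_n]
    disappears because [p_n] is orthogonal to all degrees below [n]. *)
Lemma qd_coef_mx_intertwines :
  qd_coef_mx *m hankel_U0 s = J_mx s *m (qd_coef_mx *m hankel_U1 s).
Proof.
apply/matrixP=> i j; rewrite qd_coef_mx_U0E J_mx_qd_poly [RHS]mxE.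
rewrite mulrDl linearD /= -scalerAl linearZ /=.
have [_ ->] := moment_qd_poly (fun i le_i => fshift_neq0 (leqW le_i)).
  rewrite mulr0 addr0 mulr_suml linear_sum; apply: eq_bigr => k _ /=.
  by rewrite -scalerAl linearZ /= qd_coef_mx_U1E.
by rewrite odd_double uphalf_double ltn_ord.
Qed.

(** By orthogonality the product is upper triangular; its diagonal entry [i]
    is [f_(2i)^0 / f_(2i-2)^0] up to sign. *)
Lemma det_qd_coef_mx_U1 : \det (qd_coef_mx *m hankel_U1 s) != 0.
Proof.
have lt2 (i : 'I_n) : (i.*2 < n.*2)%N by rewrite ltn_double.
have mom (i : 'I_n) := moment_qd_poly (fun k le_k =>
  fshift_neq0 (leqW (leq_trans le_k (ltnW (lt2 i))))).
rewrite -det_tr det_trig; last first.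
  apply/is_trig_mxP => i j lt_ij; rewrite mxE qd_coef_mx_U1E.
  by have [_ ->//] := mom j; rewrite odd_double uphalf_double.
apply/prodf_neq0 => i _; rewrite mxE qd_coef_mx_U1E.
have [/(_ 0%N) + _] := mom i; rewrite addn0 uphalf_double => ->.
have := ltn_ord i; rewrite /qd_moment => lt_i.
by rewrite !mulf_neq0 ?invr_eq0 ?signr_eq0 ?fshift_neq0 //; lia.
Qed.

(** Take determinants in [A (U_0 - x U_1) = (J_n - x) (A U_1)]; the matrix [A]
    of coefficients has determinant [1]. *)
Lemma pencil_poly_char_poly :
  exists2 c, c != 0 & pencil_poly s = c *: char_poly (J_mx s).
Proof.
exists ((-1) ^+ n * \det (qd_coef_mx *m hankel_U1 s)).
  by rewrite mulf_neq0 ?signr_eq0 ?det_qd_coef_mx_U1.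
set D := qd_coef_mx *m _.
have AE : map_mx polyC qd_coef_mx *m
      (map_mx polyC (hankel_U0 s) - 'X *: map_mx polyC (hankel_U1 s))
    = - char_poly_mx (J_mx s) *m map_mx polyC D.
  rewrite mulmxBr -scalemxAr -!map_mxM qd_coef_mx_intertwines -/D.
  by rewrite /char_poly_mx opprB mulmxBl map_mxM mul_scalar_mx.
have : \det (map_mx polyC qd_coef_mx) * pencil_poly s
    = \det (- char_poly_mx (J_mx s)) * \det (map_mx polyC D).
  by rewrite -!det_mulmx -AE.
rewrite !det_map_mx det_qd_coef_mx mul1r => ->.
rewrite -scaleN1r detZ -/(char_poly _) -mul_polyC polyCM rmorphXn rmorphN1 /=.
by rewrite mulrAC.
Qed.

End Companion.

(** * A point outside the exceptional set *)

Section Witness.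
Variables (C : numClosedFieldType) (n : nat).

Definition node (i : 'I_n) : C := i.+1%:R.

Lemma node_inj : injective node.
Proof. by move=> i j /eqP; rewrite eqr_nat => /eqP [] /val_inj. Qed.

Definition power_sums : (n.*2).-tuple C :=
  [tuple \sum_(i < n) node i ^+ k | k < n.*2].

Lemma nth_power_sums k : (k < n.*2)%N ->
  power_sums`_k = \sum_(i < n) node i ^+ k.
Proof.
move=> lt_k; pose k' := Ordinal lt_k.
by rewrite -[k]/(nat_of_ord k') -tnth_nth tnth_mktuple.
Qed.

Lemma moment_power_sums (p : {poly C}) : (size p <= n.*2)%N ->
  moment power_sums p = \sum_(i < n) p.[node i].
Proof.
move=> szp; rewrite -[in LHS](mulr1 p) -(expr0 'X) (moment_mulXn _ _ szp).
under [RHS]eq_bigr do rewrite (horner_coef_wide _ szp).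
rewrite exchange_big /=; apply: eq_bigr => k _.
by rewrite addn0 nth_power_sums // mulr_sumr.
Qed.

(** At the first vanishing [f_l^0], the polynomial [p = qd_poly _ l] would be
    orthogonal, for the weight [x ^ odd l], to every polynomial of its own
    degree, in particular to its conjugate: [\sum_i x_i ^ odd l * |p(x_i)| ^ 2]
    would be [0].  Then [p] would vanish at all [n] nodes, but its degree is
    less than [n]. *)
Lemma fshift_power_sums_neq0 l : (l <= n.*2.+1)%N -> fshift power_sums l 0 != 0.
Proof.
elim/ltn_ind: l => -[|[|l]] IHl le_l; rewrite ?oner_neq0 //.
apply/eqP => f0.
have [|mom orth] := @moment_qd_poly C n power_sums l.
  by move=> i le_i; apply: IHl; lia.
set p := qd_poly _ _ in mom orth.
have orth_t (t : {poly C}) : (size t <= l./2.+1)%N ->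
    moment power_sums (p * 'X^(odd l) * t) = 0.
  move=> szt; rewrite (poly_wide szt) mulr_sumr linear_sum big1 // => k _ /=.
  rewrite -scalerAr linearZ /= -mulrA -exprD.
  have := ltn_ord k; rewrite ltnS leq_eqVlt => /orP[/eqP->|lt_k].
    (* the top coefficient is where the vanishing of [f_l^0] is used *)
    have := mom 0%N; rewrite addn0 uphalf_half => ->.
    by rewrite /qd_moment f0 mulr0 mul0r mulr0.
  by rewrite orth ?mulr0 // leq_addr uphalf_half ltn_add2l.
pose t := map_poly Num.conj p.
have szp : size p = l./2.+1 by rewrite size_qd_poly.
have := orth_t t; rewrite size_map_poly szp => /(_ (leqnn _)).
have szq : size (p * 'X^(odd l)) = (l./2.+1 + odd l)%N.
  rewrite size_monicM ?qd_poly_monic ?monic_neq0 ?monicXn // size_polyXn szp.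
  by lia.
rewrite moment_power_sums; last first.
  rewrite (leq_trans (size_polyMleq _ _)) // szq size_map_poly szp.
  by rewrite -[X in (_ <= X)%N]/(n.*2); have := odd_double_half l; lia.
have term (i : 'I_n) : (p * 'X^(odd l) * t).[node i]
    = node i ^+ odd l * `|p.[node i]| ^+ 2.
  rewrite !hornerM hornerXn normCK -horner_map /= -/t.
  by rewrite (conjC_nat C i.+1) -mulrA mulrCA.
under eq_bigr do rewrite term.
have node_gt0 i : 0 < node i ^+ odd l by rewrite exprn_gt0 ?ltr0Sn.
move/eqP; rewrite psumr_eq0 => [/allP all0|i _]; last first.
  by rewrite mulr_ge0 ?exprn_ge0 // ltW.
have roots : all (root p) [seq node i | i <- enum 'I_n].
  apply/allP => _ /mapP[i _ ->]; have := all0 i (mem_index_enum _).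
  by rewrite mulf_eq0 gt_eqF //= sqrf_eq0 normr_eq0.
have := max_poly_roots (monic_neq0 (qd_poly_monic _ _)) roots.
rewrite map_inj_uniq ?enum_uniq; last exact: node_inj.
by rewrite size_map size_enum_ord szp => /(_ isT); lia.
Qed.

Lemma J_defined_power_sums : J_defined power_sums.
Proof. by move=> l lt_l; apply: fshift_power_sums_neq0. Qed.

(** With the Vandermonde matrix [V] of the nodes, the pencil factors as
    [V^T diag(x_i - z) V]. *)
Lemma pencil_poly_power_sums :
  exists c, pencil_poly power_sums = c *: \prod_(i < n) ('X - (node i)%:P).
Proof.
pose V : 'M[C]_n := \matrix_(i, j) node i ^+ j.
pose D : 'rV[{poly C}]_n := \row_i ((node i)%:P - 'X).
exists ((-1) ^+ n * \det V ^+ 2).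
have -> : pencil_poly power_sums
    = \det ((map_mx polyC V)^T *m diag_mx D *m map_mx polyC V).
  congr (\det _); apply/matrixP => i j.
  have lt_ij : (i + j + 1 < n.*2)%N.
    by have := ltn_ord i; have := ltn_ord j; lia.
  rewrite !mxE !nth_power_sums //; last by rewrite ltnW // -addn1.
  rewrite !rmorph_sum mulr_sumr -sumrB; apply: eq_bigr => k _ /=.
  rewrite mul_mx_diag !mxE !rmorphXn /= !exprD expr1.
  by ring.
rewrite !det_mulmx det_tr det_diag det_map_mx.
under eq_bigr do rewrite mxE -opprB.
rewrite prodrN card_ord -mul_polyC polyCM !rmorphXn rmorphN1 /=.
by ring.
Qed.

Lemma simple_eigenvalues_power_sums : simple_eigenvalues power_sums.
Proof.
have [c c_eq] := pencil_poly_power_sums.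
have [a a_neq0 a_eq] := pencil_poly_char_poly J_defined_power_sums.
(* [c] is the squared Vandermonde determinant up to sign; that it is nonzero
   follows at once from the pencil being regular *)
have c_neq0 : c != 0.
  apply: contra_neq a_neq0 => c0; move: c_eq; rewrite c0 scale0r a_eq.
  move/eqP; rewrite scaler_eq0 (negPf (monic_neq0 (char_poly_monic _))) orbF.
  by move/eqP.
move=> z; rewrite c_eq rootZ // -mul_polyC.
have -> : \prod_(i < n) ('X - (node i)%:P)
    = \prod_(x <- [seq node i | i <- enum 'I_n]) ('X - x%:P).
  by rewrite big_map big_enum.
rewrite root_prod_XsubC => z_node.
rewrite mupMr ?rootC // mu_prod_XsubC count_uniq_mem ?z_node //.
by rewrite map_inj_uniq ?enum_uniq //; apply: node_inj.
Qed.

End Witness.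

(** * Zero sets of complex polynomials *)

Section Semialgebraic.
Variables (R : rcfType) (m : nat).

(** The real and imaginary parts of [f] are real polynomials in the real
    coordinates. *)
Definition real_polynomial_parts (f : m.-tuple R[i] -> R[i]) :=
  exists P Q : {mpoly R[m + m]}, forall s,
    f s = P.@[tnth (real_coords s)] +i* Q.@[tnth (real_coords s)].

Lemma real_parts_const c : real_polynomial_parts (fun=> c).
Proof.
by exists (complex.Re c)%:MP, (complex.Im c)%:MP => s; rewrite !mevalC; case: c.
Qed.

Lemma real_parts_coord i : real_polynomial_parts (fun s => tnth s i).
Proof.
exists 'X_(lshift m i), 'X_(rshift m i) => s; rewrite !mevalXU.
rewrite !(tnth_nth 0) /= !nth_cat !size_map size_tuple ltn_ord.
rewrite ltnNge leq_addr /= addKn !(nth_map 0) ?size_tuple ?ltn_ord //.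
by case: s`_i.
Qed.

Lemma real_partsD f g : real_polynomial_parts f -> real_polynomial_parts g ->
  real_polynomial_parts (fun s => f s + g s).
Proof.
move=> [P [Q fE]] [P' [Q' gE]]; exists (P + P'), (Q + Q') => s.
by rewrite fE gE !mevalD.
Qed.

Lemma real_partsM f g : real_polynomial_parts f -> real_polynomial_parts g ->
  real_polynomial_parts (fun s => f s * g s).
Proof.
move=> [P [Q fE]] [P' [Q' gE]].
exists (P * P' - Q * Q'), (P * Q' + Q * P') => s.
by rewrite fE gE !mevalD mevalN !mevalM.
Qed.

Lemma real_parts_meval (F : {mpoly R[i][m]}) :
  real_polynomial_parts (fun s => F.@[tnth s]).
Proof.
elim/mpolyind: F => [|c mon F _ _ IHF].
  by have [P [Q E]] := real_parts_const 0; exists P, Q => s; rewrite meval0.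
have [P [Q E]] : real_polynomial_parts
    (fun s => c * \prod_i tnth s i ^+ mon i + F.@[tnth s]).
  apply: real_partsD => //; apply: real_partsM (real_parts_const c) _.
  elim: (index_enum _) => [|i e IHe].
    have [P [Q E]] := real_parts_const 1.
    by exists P, Q => s; rewrite big_nil.
  have [P [Q E]] : real_polynomial_parts
      (fun s => tnth s i ^+ mon i * \prod_(j <- e) tnth s j ^+ mon j).
    apply: real_partsM IHe; elim: (mon i) => [|k IHk].
      exact: real_parts_const.
    have [P [Q E]] := real_partsM (real_parts_coord i) IHk.
    by exists P, Q => s; rewrite exprS.
  by exists P, Q => s; rewrite big_cons.
by exists P, Q => s; rewrite mevalD mevalZ mevalX.
Qed.

Lemma real_coords_surj (x : (m + m).-tuple R) : exists s, real_coords s = x.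
Proof.
have [s sE] : exists s : m.-tuple R[i], forall k : 'I_m,
    s`_k = tnth x (lshift m k) +i* tnth x (rshift m k).
  exists [tuple tnth x (lshift m i) +i* tnth x (rshift m i) | i < m] => k.
  by rewrite -tnth_nth tnth_mktuple.
exists s; apply: eq_from_tnth => i; rewrite (tnth_nth 0) /= nth_cat size_map.
rewrite size_tuple; case: (splitP i) => [k|k] eq_ik.
  rewrite eq_ik (nth_map 0) ?size_tuple // sE /=.
  by congr tnth; apply: val_inj.
rewrite eq_ik addKn (nth_map 0) ?size_tuple // sE /=.
by congr tnth; apply: val_inj.
Qed.

Lemma zero_set_semialgebraic (F : {mpoly R[i][m]}) :
  complex_semialgebraic [set s | F.@[tnth s] = 0].
Proof.
have [P [Q FE]] := real_parts_meval F.
exists [:: ([:: P; Q], [::])] => x /=; rewrite !andbT orbF.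
split=> [[s /= Fs0 <-]|].
  by move: Fs0; rewrite FE => -[-> ->]; rewrite !eqxx.
have [s <-] := real_coords_surj x => /andP[/eqP P0 /eqP Q0].
by exists s => //=; rewrite FE P0 Q0.
Qed.

End Semialgebraic.

(** * Simple roots and resultants *)

Section Simple.

(** At a root [z], the root is simple exactly when the derivative is nonzero
    there; over a closed field coprimality is the absence of common roots. *)
Lemma simple_roots_coprimep (C : closedFieldType) (p : {poly C}) : p != 0 ->
  (forall z, root p z -> mup z p = 1%N) <-> coprimep p p^`().
Proof.
move=> p_neq0.
have mup1 z : root p z -> (mup z p == 1%N) = ~~ root p^`() z.
  move=> pz; have [q pE] := factor_theorem _ _ pz.
  have mup_gt0 : (0 < mup z p)%N by rewrite -XsubC_dvd // dvdp_XsubCl.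
  rewrite eqn_leq mup_gt0 andbT -[(_ <= 1)%N]/(mup z p < 2)%N mup_ltn //.
  rewrite {1}pE expr2 dvdp_mul2r ?polyXsubC_eq0 // dvdp_XsubCl.
  by rewrite /root [in RHS]pE derivM derivXsubC mulr1 !hornerE
             subrr mulr0 add0r.
split=> [simp|/Pdiv.ClosedField.coprimepP cop z pz].
  apply/Pdiv.ClosedField.coprimepP => z pz.
  by have := mup1 z pz; rewrite simp.
by apply/eqP; rewrite mup1 //; apply: cop.
Qed.

Lemma map_lead_coef_neq0 (A : nzRingType) (B : nzRingType)
    (f : {rmorphism A -> B}) (p : {poly A}) N :
  (size p <= N.+1)%N -> f p`_N != 0 -> f (lead_coef p) != 0.
Proof.
move=> szp fpN; rewrite /lead_coef; suff -> : size p = N.+1 by [].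
apply/eqP; rewrite eqn_leq szp /=; rewrite ltnNge; apply: contraNN fpN => szpN.
by rewrite nth_default ?rmorph0.
Qed.

(** The format of the Sylvester matrix depends on the degrees, so the resultant
    commutes with a morphism only if neither degree drops. *)
Lemma map_resultant_lead (A B : comNzRingType) (f : {rmorphism A -> B})
    (p q : {poly A}) :
    f (lead_coef p) != 0 -> f (lead_coef q) != 0 ->
  f (resultant p q) = resultant (map_poly f p) (map_poly f q).
Proof.
move=> fp_neq0 fq_neq0.
rewrite /resultant /Sylvester_mx !size_map_poly_id0 // -det_map_mx map_col_mx.
congr (\det (col_mx _ _)); apply/matrixP => i j; rewrite !mxE /= !rVpoly_delta.
  by rewrite !coefXnM coef_map; case: ifP; rewrite ?rmorph0.
by rewrite !coefXnM coef_map; case: ifP; rewrite ?rmorph0.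
Qed.

(** If the image of [p] has the largest possible degree, the degree of the
    derivative does not drop either, in characteristic zero. *)
Lemma map_resultant_deriv (A : idomainType) (C : numFieldType)
    (f : {rmorphism A -> C}) (p : {poly A}) N :
  (size p <= N.+2)%N -> size (map_poly f p) = N.+2 ->
  f (resultant p p^`()) = resultant (map_poly f p) (map_poly f p)^`().
Proof.
move=> szp szfp; have fpN : f p`_N.+1 != 0.
  rewrite -coef_map -[N.+1]/(N.+2.-1) -szfp -/(lead_coef _) lead_coef_eq0.
  by rewrite -size_poly_eq0 szfp.
rewrite deriv_map map_resultant_lead ?(map_lead_coef_neq0 szp) //.
apply: (@map_lead_coef_neq0 _ _ _ _ N).
  by rewrite (leq_trans (size_poly _ _)) //; move: szp; case: (size p).
by rewrite coef_deriv rmorphMn mulrn_eq0.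
Qed.

End Simple.

(** * The array of the recurrence without divisions *)

Section Cleared.

(** The recurrence of [fshift] without its prefactor [(-1) ^+ l / fshift l 0];
    it makes sense in any ring, hence for the generic sequence. *)
Fixpoint cleared (A : pzRingType) (s : seq A) (m k : nat) {struct m} : A :=
  match m with
  | 0 | 1 => (k == 0%N)%:R
  | 2 => s`_k
  | ((l.+1 as l1).+1 as l2).+1 =>
      cleared s l2 0 * cleared s l1 k.+1 - cleared s l1 0 * cleared s l2 k.+1
  end.

Lemma cleared_rec (A : pzRingType) (s : seq A) l k :
  cleared s l.+3 k =
    cleared s l.+2 0 * cleared s l.+1 k.+1
    - cleared s l.+1 0 * cleared s l.+2 k.+1.
Proof. by []. Qed.

Lemma map_cleared (A B : pzRingType) (f : {rmorphism A -> B}) (s : seq A) m k :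
  f (cleared s m k) = cleared (map f s) m k.
Proof.
elim/ltn_ind: m k => -[|[|[|m]]] IHm k; try exact: rmorph_nat.
  have [lt_k|ge_k] := ltnP k (size s); first by rewrite /= (nth_map 0).
  by rewrite /= !nth_default ?size_map ?rmorph0.
by rewrite !cleared_rec rmorphB !rmorphM !IHm.
Qed.

Variables (C : fieldType) (n : nat) (s : (n.*2).-tuple C).

(** The recurrence is bilinear in two consecutive levels, and the scaling
    factor [u] of a level does not depend on [k]: the omitted prefactors only
    rescale whole levels. *)
Lemma cleared_fshift m : (forall i, (i < m)%N -> fshift s i 0 != 0) ->
  exists2 u, u != 0 & forall k, cleared s m k = u * fshift s m k.
Proof.
elim/ltn_ind: m => -[|[|[|m]]] IHm f_neq0.
1-3: by exists 1; [exact: oner_neq0 | move=> k; rewrite mul1r].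
have [||u u_neq0 uE] := IHm m.+1; first lia.
  by move=> i lt_i; apply: f_neq0; lia.
have [||v v_neq0 vE] := IHm m.+2; first lia.
  by move=> i lt_i; apply: f_neq0; lia.
have fm : fshift s m 0 != 0 by apply: f_neq0; lia.
exists ((-1) ^+ m * u * v * fshift s m 0).
  by rewrite !mulf_neq0 ?signr_eq0.
move=> k; rewrite fshift_rec cleared_rec !uE !vE.
have e : (-1) ^+ m * (-1) ^+ m = 1 :> C by rewrite -expr2 sqrr_sign.
by field: e.
Qed.

Lemma J_definedP :
  J_defined s <-> \prod_(l < n.*2) cleared s l.+2 0 != 0.
Proof.
have cleared_neq0 m : (forall i, (i < m)%N -> fshift s i 0 != 0) ->
    (cleared s m 0 != 0) = (fshift s m 0 != 0).
  by move=> /cleared_fshift[u u0 ->]; rewrite mulf_eq0 negb_or u0.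
split=> [J_def|/prodf_neq0 cl_neq0 l lt_l].
  apply/prodf_neq0 => l _; rewrite cleared_neq0 ?J_def // => i lt_i.
  by rewrite fshift_neq0 //; have := ltn_ord l; lia.
suff f_neq0 m : (m <= n.*2.+1)%N -> fshift s m 0 != 0 by apply: f_neq0.
elim/ltn_ind: m => -[|[|m]] IHm le_m; rewrite ?oner_neq0 //.
have f_lt i : (i < m.+2)%N -> fshift s i 0 != 0 by move=> lt_i; apply: IHm; lia.
rewrite -(cleared_neq0 _ f_lt); have lt_m : (m < n.*2)%N by [].
exact: cl_neq0 (Ordinal lt_m) isT.
Qed.

End Cleared.

(** * The polynomial defining the exceptional set *)

Section Universal.
Variables (C : numClosedFieldType) (n : nat).

Definition generic_seq : seq {mpoly C[n.*2]} := [seq 'X_i | i <- enum 'I_n.*2].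

Definition generic_pencil : {poly {mpoly C[n.*2]}} :=
  \det (\matrix_(i < n, j < n)
    ((generic_seq`_(i + j + 1))%:P - 'X * (generic_seq`_(i + j))%:P)).

Definition exceptional_poly : {mpoly C[n.*2]} :=
  \prod_(l < n.*2) cleared generic_seq l.+2 0
    * resultant generic_pencil generic_pencil^`().

Variable s : (n.*2).-tuple C.

Lemma map_generic_seq : map (meval (tnth s)) generic_seq = s.
Proof.
rewrite -map_comp -[RHS](map_tnth_enum s).
by apply: eq_map => i /=; rewrite mevalXU.
Qed.

Lemma map_generic_pencil :
  map_poly (meval (tnth s)) generic_pencil = pencil_poly s.
Proof.
have nthE k : (generic_seq`_k).@[tnth s] = s`_k.
  have [lt_k|ge_k] := ltnP k (size generic_seq).
    by rewrite -map_generic_seq (nth_map 0).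
  by rewrite -map_generic_seq !nth_default ?meval0 // size_map.
rewrite -det_map_mx; congr (\det _); apply/matrixP=> i j; rewrite !mxE.
by rewrite rmorphB rmorphM /= map_polyX !map_polyC /= !nthE.
Qed.

(** The bound [n] on the degree is needed before specialization: it ensures
    that the degree does not drop at the points where [J_n] is defined. *)
Lemma size_generic_pencil : (size generic_pencil <= n.+1)%N.
Proof.
apply: (leq_trans (size_sum _ _ _)); apply/bigmax_leqP => sigma _.
rewrite size_Msign (leq_trans (size_prod_leq _ _)) //.
rewrite leq_subLR card_ord.
have le2 (a b : {mpoly C[n.*2]}) : (size (a%:P - 'X * b%:P)%R <= 2)%N.
  rewrite (leq_trans (size_polyD _ _)) // geq_max.
  rewrite (leq_trans (size_polyC_leq1 _)) // size_polyN mulrC mul_polyC.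
  by rewrite (leq_trans (size_scale_leq _ _)) // size_polyX.
under eq_bigr do rewrite mxE.
rewrite addnS ltnS (leq_trans (leq_sum _ (E2 := fun=> 2%N) _)) //.
by rewrite sum_nat_const card_ord; lia.
Qed.

(** Where the first factor is nonzero, the pencil polynomial has degree exactly
    [n], so the generic resultant specializes to that of the pencil polynomial
    and its derivative. *)
Lemma exceptional_polyP : (0 < n)%N ->
  simple_eigenvalues s /\ J_defined s <-> exceptional_poly.@[tnth s] != 0.
Proof.
move=> n_gt0; rewrite rmorphM mulf_eq0 negb_or rmorph_prod /=.
have clearedE l : (cleared generic_seq l.+2 0).@[tnth s] = cleared s l.+2 0.
  by rewrite -map_generic_seq; apply: (map_cleared (meval (tnth s))).
under eq_bigr do rewrite clearedE.
have res_neq0 : J_defined s ->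
    (simple_eigenvalues s <->
     (resultant generic_pencil generic_pencil^`()).@[tnth s] != 0).
  move=> /pencil_poly_char_poly[c c_neq0 pE].
  have szp : size (pencil_poly s) = n.+1.
    by rewrite pE size_scale // size_char_poly.
  have p_neq0 : pencil_poly s != 0 by rewrite -size_poly_eq0 szp.
  have szg : (size generic_pencil <= n.-1.+2)%N.
    by rewrite prednK // size_generic_pencil.
  have szfp : size (map_poly (meval (tnth s)) generic_pencil) = n.-1.+2.
    by rewrite map_generic_pencil prednK.
  rewrite (map_resultant_deriv szg szfp) map_generic_pencil resultant_eq0.
  rewrite -leqNgt.
  have -> : (size (gcdp (pencil_poly s) (pencil_poly s)^`()) <= 1)%N
       = coprimep (pencil_poly s) (pencil_poly s)^`().
    rewrite /coprimep eqn_leq [(0 < _)%N]lt0n size_poly_eq0 gcdp_eq0.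
    by rewrite (negPf p_neq0) andbT.
  exact: simple_roots_coprimep.
split=> [[simp Jd]|/andP[/J_definedP Jd /res_neq0 simp]].
  by apply/andP; split; [apply/J_definedP | apply/res_neq0].
by split=> //; apply: simp.
Qed.

End Universal.

Theorem corollary10 (R : realType) (n : nat) (n_ge1 : (1 <= n)%N) :
  let exceptional : set ((n.*2).-tuple R[i]) :=
    [set s | ~ (simple_eigenvalues s /\ J_defined s)] in
  [/\ complex_semialgebraic exceptional,
      exceptional <> setT
    & forall s : (n.*2).-tuple R[i],
        simple_eigenvalues s -> J_defined s ->
        forall z : R[i], eigenvalue (J_mx s) z = root (pencil_poly s) z].
Proof.
split.
- have -> : [set s | ~ (simple_eigenvalues s /\ J_defined s)]
      = [set s | (exceptional_poly R[i] n).@[tnth s] = 0].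
    apply/seteqP; split=> s /=.
      move=> exc; apply/eqP; apply: contra_notT exc.
      by move/(exceptional_polyP _ n_ge1).
    by move=> F0 /(exceptional_polyP _ n_ge1); rewrite F0 eqxx.
  exact: zero_set_semialgebraic.
- move/seteqP => [_ /(_ (power_sums R[i] n) I) /=]; apply.
  split; first exact: simple_eigenvalues_power_sums.
  exact: J_defined_power_sums.
- move=> s _ /pencil_poly_char_poly[c c_neq0 ->] z.
  by rewrite eigenvalue_root_char rootZ.
Qed.
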